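(* Let $(\mathcal{A},[\cdot,\cdot],\circ)$ be a super Gel'fand-Dorfman bialgebra equipped with an even algebra endomorphism $\alpha$. Define $$x\circ_\alpha y=\alpha(x)\circ\alpha(y),\qquad [x,y]_\alpha=[\alpha(x),\alpha(y)],\qquad \forall\, x,y\in\mathcal{A}.$$ Then $(\mathcal{A},[\cdot,\cdot]_\alpha,\circ_\alpha,\alpha)$ is a super Hom-Gel'fand-Dorfman bialgebra.
   Context: All linear spaces are over $\mathbb{C}$. A superspace is a $\mathbb{Z}_2$-graded linear space $\mathcal{A}=\mathcal{A}_0\oplus\mathcal{A}_1$; $|x|\in\{0,1\}$ is the parity of a homogeneous element $x$. Formulas containing $|x|$ are stated for homogeneous elements and extended by linearity. Hom-Lie superalgebra $(\mathcal{A},[\cdot,\cdot],\alpha)$: a superspace with an even bilinear map $[\cdot,\cdot]:\mathcal{A}\times\mathcal{A}\to\mathcal{A}$ and an even linear map $\alpha:\mathcal{A}\to\mathcal{A}$ such that for all homogeneous $x,y,z$: $[x,y]=-(-1)^{|x||y|}[y,x]$ and $(-1)^{|x||z|}[[x,y],\alpha(z)]+(-1)^{|x||y|}[[y,z],\alpha(x)]+(-1)^{|y||z|}[[z,x],\alpha(y)]=0$. Hom-Novikov superalgebra $(\mathcal{A},\circ,\alpha)$: a superspace with an even bilinear operation $\circ$ and an even linear map $\alpha$ such that for all homogeneous $x,y,z$: $(x\circ y)\circ\alpha(z)-\alpha(x)\circ(y\circ z)=(-1)^{|x||y|}\big((y\circ x)\circ\alpha(z)-\alpha(y)\circ(x\circ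 z)\big)$ and $(x\circ y)\circ\alpha(z)=(-1)^{|y||z|}(x\circ z)\circ\alpha(y)$. Super Hom-Gel'fand-Dorfman bialgebra $(\mathcal{A},[\cdot,\cdot],\circ,\alpha)$: a superspace with an even linear map $\alpha$ and two operations such that $(\mathcal{A},[\cdot,\cdot],\alpha)$ is a Hom-Lie superalgebra, $(\mathcal{A},\circ,\alpha)$ is a Hom-Novikov superalgebra, and for all homogeneous $x,y,z$: $[x\circ y,\alpha(z)]-(-1)^{|y||z|}[x\circ z,\alpha(y)]+[x,y]\circ\alpha(z)-(-1)^{|y||z|}[x,z]\circ\alpha(y)-\alpha(x)\circ[y,z]=0$. A super Gel'fand-Dorfman bialgebra $(\mathcal{A},[\cdot,\cdot],\circ)$ is the case $\alpha=\mathrm{id}$ of this definition (so $(\mathcal{A},[\cdot,\cdot])$ is a Lie superalgebra, $(\mathcal{A},\circ)$ is a Novikov superalgebra, and the compatibility condition holds with $\alpha=\mathrm{id}$). An even algebra endomorphism of it is an even linear map $\alpha:\mathcal{A}\to\mathcal{A}$ with $\alpha([x,y])=[\alpha(x),\alpha(y)]$ and $\alpha(x\circ y)=\alpha(x)\circ\alpha(y)$ for all $x,y$. *)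

(* Defs.v *)
From mathcomp Require Import all_boot all_order all_algebra.
From mathcomp Require Import reals complex.

Set Implicit Arguments.
Unset Strict Implicit.
Unset Printing Implicit Defensive.

Import GRing.Theory.
Local Open Scope ring_scope.
Local Open Scope complex_scope.

(* The field of complex numbers is R[i] for a model R of the real numbers.
   A : 'Z_2 -> {pred _} is the internal grading.  Parities are read off
   membership, so the element 0 is homogeneous of both parities; every formula
   below holds trivially as soon as one of its arguments is 0. *)
Record superspace (R : realType) := Superspace {
  superspace_sort :> lmodType R[i];
  homog : 'Z_2 -> {pred superspace_sort};
  homog_submod : forall i, submod_closed (homog i);
  homog_span : forall x, exists x0 x1,
    [/\ x0 \in homog 0, x1 \in homog 1 & x = x0 + x1];
  homog_direct : forall x, x \in homog 0 -> x \in homog 1 -> x = 0 }.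

Arguments homog {R} s i.

(* (-1)^{|x||y|} for |x| = i and |y| = j *)
Definition ksign (R : realType) (i j : 'Z_2) : R[i] := (-1) ^+ (i * j)%N.

Section SuperAlgebras.
Variables (R : realType) (V : superspace R).
Implicit Types (alpha : V -> V) (br op : V -> V -> V).

Local Notation "''s_' ( i , j )" := (ksign R i j)
  (format "''s_' ( i ,  j )").

Record even_linear alpha : Prop := EvenLinear {
  even_linear_lin : linear alpha;
  even_linear_even : forall i x, x \in homog V i -> alpha x \in homog V i }.

Record even_bilinear op : Prop := EvenBilinear {
  even_bilinear_bilin : bilinear_for *:%R *:%R op;
  even_bilinear_even : forall i j x y,
    x \in homog V i -> y \in homog V j -> op x y \in homog V (i + j) }.

Record hom_lie_superalgebra br alpha : Prop := HomLieSuperalgebra {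
  hom_lie_bracket : even_bilinear br;
  hom_lie_twist : even_linear alpha;
  hom_lie_skew : forall i j x y, x \in homog V i -> y \in homog V j ->
    br x y = - ('s_(i, j) *: br y x);
  hom_lie_jacobi : forall i j k x y z,
    x \in homog V i -> y \in homog V j -> z \in homog V k ->
    's_(i, k) *: br (br x y) (alpha z) + 's_(i, j) *: br (br y z) (alpha x)
      + 's_(j, k) *: br (br z x) (alpha y) = 0 }.

Record hom_novikov_superalgebra op alpha : Prop := HomNovikovSuperalgebra {
  hom_novikov_product : even_bilinear op;
  hom_novikov_twist : even_linear alpha;
  hom_novikov_left_sym : forall i j k x y z,
    x \in homog V i -> y \in homog V j -> z \in homog V k ->
    op (op x y) (alpha z) - op (alpha x) (op y z) =
      's_(i, j) *: (op (op y x) (alpha z) - op (alpha y) (op x z));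
  hom_novikov_right_comm : forall i j k x y z,
    x \in homog V i -> y \in homog V j -> z \in homog V k ->
    op (op x y) (alpha z) = 's_(j, k) *: op (op x z) (alpha y) }.

Record super_hom_GD_bialgebra br op alpha : Prop := SuperHomGDBialgebra {
  hom_GD_lie : hom_lie_superalgebra br alpha;
  hom_GD_novikov : hom_novikov_superalgebra op alpha;
  hom_GD_compat : forall i j k x y z,
    x \in homog V i -> y \in homog V j -> z \in homog V k ->
    br (op x y) (alpha z) - 's_(j, k) *: br (op x z) (alpha y)
      + op (br x y) (alpha z) - 's_(j, k) *: op (br x z) (alpha y)
      - op (alpha x) (br y z) = 0 }.

Definition super_GD_bialgebra br op : Prop := super_hom_GD_bialgebra br op id.

Record even_endomorphism br op alpha : Prop := EvenEndomorphism {
  even_endo_linear : even_linear alpha;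
  even_endo_bracket : forall x y, alpha (br x y) = br (alpha x) (alpha y);
  even_endo_product : forall x y, alpha (op x y) = op (alpha x) (alpha y) }.

Definition twist_op alpha op : V -> V -> V :=
  fun x y => op (alpha x) (alpha y).

End SuperAlgebras.

(* Main.v *)
(* Since alpha is multiplicative, every twisted monomial of degree 3 in x, y, z
   is the untwisted one in alpha^2 x, alpha^2 y, alpha^2 z; as alpha^2 preserves
   parity, each twisted ternary axiom is the untwisted one evaluated there. *)
Require Import Defs.
From mathcomp Require Import all_boot all_order all_algebra.
From mathcomp Require Import reals complex.

Section Twist.
Context (R : realType) (V : superspace R).
Implicit Types (alpha : V -> V) (br op : V -> V -> V).

Lemma even_bilinear_twist op alpha :
  even_bilinear op -> even_linear alpha -> even_bilinear (twist_op alpha op).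
Proof.
move=> [[linl linr] op_even] [lin even]; split.
- by split=> [u' | u] a x y; rewrite /twist_op lin; [apply: linl | apply: linr].
- by move=> i j x y hx hy; apply: op_even; apply: even.
Qed.

Lemma hom_lie_superalgebra_twist br alpha :
  hom_lie_superalgebra br id -> even_linear alpha ->
  (forall x y, alpha (br x y) = br (alpha x) (alpha y)) ->
  hom_lie_superalgebra (twist_op alpha br) alpha.
Proof.
move=> [bil _ skew jacobi] lin morph; split=> //.
- exact: even_bilinear_twist.
(* Degree 2: each argument receives a single [alpha], so this is the original law at [alpha x] and
   [alpha y]. *)
- by move=> i j x y hx hy; apply: skew; apply: (even_linear_even lin).
- move=> i j k x y z hx hy hz; rewrite /twist_op !morph.
  (* The [id] twist of [jacobi] disappears by conversion; parity is carried through the two layers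
     of [alpha]. *)
  by apply: (jacobi i j k); do 2!apply: (even_linear_even lin).
Qed.

Lemma hom_novikov_superalgebra_twist op alpha :
  hom_novikov_superalgebra op id -> even_linear alpha ->
  (forall x y, alpha (op x y) = op (alpha x) (alpha y)) ->
  hom_novikov_superalgebra (twist_op alpha op) alpha.
Proof.
move=> [bil _ lsym rcomm] lin morph; split=> //.
- exact: even_bilinear_twist.
- move=> i j k x y z hx hy hz; rewrite /twist_op !morph.
  (* The sign involves only [i] and [j], so [k] cannot be inferred from the goal. *)
  by apply: (lsym i j k); do 2!apply: (even_linear_even lin).
- move=> i j k x y z hx hy hz; rewrite /twist_op !morph.
  by apply: (rcomm i j k); do 2!apply: (even_linear_even lin).
Qed.

End Twist.

Theorem theorem3p7 (R : realType) (V : superspace R)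
    (br op : V -> V -> V) (alpha : V -> V)
    (hGD : super_GD_bialgebra br op)
    (halpha : even_endomorphism br op alpha) :
  super_hom_GD_bialgebra (twist_op alpha br) (twist_op alpha op) alpha.
Proof.
case: hGD halpha => lie nov compat [lin br_morph op_morph]; split.
- exact: hom_lie_superalgebra_twist.
- exact: hom_novikov_superalgebra_twist.
(* Each term nests one operation inside the other, so [alpha] has to pass through both [br] and
   [op]. *)
- move=> i j k x y z hx hy hz; rewrite /twist_op !(br_morph, op_morph).
  by apply: (compat i j k); do 2!apply: (even_linear_even lin).
Qed.
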